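(* Let $p$ be the period of $f(x)=a^x \bmod n$, where $0<a<n$ and $\gcd(a,n)=1$, and let $N$ be a power of $2$ with $n^2<N<2n^2$. Then there exist $p$ pairwise different natural numbers $t_k$, $0\le k\le p-1$, such that $$t_k\in\left[k\frac{N}{p}-\frac12,\;k\frac{N}{p}+\frac12\right]\quad\text{for all } 0\le k\le p-1 .$$
   Context: Natural numbers include $0$. The function $f:\mathbb{N}\to\mathbb{N}$, $f(x)=a^x\bmod n$, is modular exponentiation, where $z\bmod n$ is the remainder of $z$ on division by $n$. Its period $p$ is the smallest positive integer with $f(x)=f(x+p)$ for all $x\in\mathbb{N}$. *)

(* Defs.v *)
From mathcomp Require Import all_boot all_order all_algebra.
Set Implicit Arguments.
Unset Strict Implicit.
Unset Printing Implicit Defensive.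

Definition modexp (a n x : nat) : nat := a ^ x %% n.

Definition is_shift_period (f : nat -> nat) (q : nat) : Prop :=
  0 < q /\ forall x : nat, f x = f (x + q).

Definition is_period (f : nat -> nat) (p : nat) : Prop :=
  is_shift_period f p /\ forall q : nat, is_shift_period f q -> p <= q.

Definition power_of_2 (N : nat) : Prop := exists m : nat, N = 2 ^ m.

(* Main.v *)
Require Import Defs.
From mathcomp Require Import all_boot all_order all_algebra.
From mathcomp Require Import cyclic zify ring.
Import Order.TTheory GRing.Theory Num.Theory.
Local Open Scope ring_scope.

(** Take for [t k] the integer nearest to [k * N / p].  It lies within [1/2] of
    that point by construction ([nearest_itv]), and rounding sends points at
    distance at least [1] to different integers ([nearest_inj]), so the [t k]
    are distinct as soon as [p <= N].  By Euler's theorem [totient n] is a shift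
    period of [x |-> a ^ x mod n], so minimality of the period gives
    [p <= totient n <= n] ([period_modexp_le]), and [n <= n ^ 2 < N]. *)

Lemma totient_le n : (totient n <= n)%N.
Proof.
rewrite totient_count_coprime -[leqRHS]card_ord -sum1_card big_mkord.
by apply: leq_sum => i _; apply: leq_b1.
Qed.

(** Coprimality is what makes Euler's theorem, hence pure periodicity from [0],
    available. *)
Lemma period_modexp_le a n p :
  (0 < n)%N -> coprime a n -> is_period (modexp a n) p -> (p <= n)%N.
Proof.
move=> n_gt0 co_an [_ p_min]; apply: leq_trans (totient_le n).
apply: p_min; split=> [|x]; first by rewrite totient_gt0.
by rewrite /modexp expnD -modnMmr Euler_exp_totient // modnMmr muln1.
Qed.

(** Rounding to the nearest natural number, [floor (m / p + 1/2)], written over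
    the common denominator [2 * p] so that it is a Euclidean quotient. *)
Definition nearest (m p : nat) : nat := ((2 * m + p) %/ (2 * p))%N.

Lemma nearest_itv (R : realFieldType) (m p : nat) : (0 < p)%N ->
  (nearest m p)%:R \in `[m%:R / p%:R - 1 / 2%:R, m%:R / p%:R + 1 / 2%:R :> R].
Proof.
move=> p_gt0; have p_neq0 : p%:R != 0 :> R by rewrite pnatr_eq0 -lt0n.
have den_gt0 : 0 < (2 * p)%:R :> R by rewrite ltr0n muln_gt0.
have -> : m%:R / p%:R - 1 / 2%:R = ((2 * m)%:R - p%:R) / (2 * p)%:R :> R.
  by rewrite !natrM; field.
have -> : m%:R / p%:R + 1 / 2%:R = ((2 * m)%:R + p%:R) / (2 * p)%:R :> R.
  by rewrite !natrM; field.
rewrite in_itv /= ler_pdivrMr // ler_pdivlMr // lerBlDr.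
rewrite -natrM -!natrD !ler_nat leq_divM andbT -(leq_add2r p).
have := ltn_ceil (2 * m + p) (_ : 0 < 2 * p)%N; rewrite /nearest.
by rewrite muln_gt0 p_gt0 => /(_ isT); rewrite mulSn; lia.
Qed.

(** Raising [m] by [p] raises the rounded quotient by exactly [1], so points
    [k * (N / p)] whose spacing is at least [1] are strictly ordered after
    rounding. *)
Lemma nearest_lt (N p i j : nat) :
  (0 < p <= N)%N -> (i < j)%N -> (nearest (i * N) p < nearest (j * N) p)%N.
Proof.
move=> /andP[p_gt0 le_pN] lt_ij.
have le_num : (2 * p + (2 * (i * N) + p) <= 2 * (j * N) + p)%N.
  by have := leq_mul lt_ij (leqnn N); rewrite mulSn; lia.
apply: leq_trans (leq_div2r _ le_num).
by rewrite divnDl // divnn muln_gt0 p_gt0.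
Qed.

Lemma nearest_inj (N p : nat) :
  (0 < p <= N)%N -> injective (fun k : 'I_p => nearest (k * N) p).
Proof.
move=> p_range i j eq_ij; apply: val_inj.
by case: (ltngtP i j) => // /(nearest_lt _ _ _ _ p_range); rewrite eq_ij ltnn.
Qed.

Theorem corollary52 (R : realFieldType) (a n p N : nat)
    (ha : (0 < a < n)%N) (hcop : gcdn a n = 1%N)
    (hp : is_period (modexp a n) p)
    (hN : power_of_2 N) (hNn : (n ^ 2 < N < 2 * n ^ 2)%N) :
  exists t : 'I_p -> nat,
    injective t /\
    forall k : 'I_p,
      (t k)%:R \in `[k%:R * (N%:R / p%:R) - 1 / 2%:R,
                     k%:R * (N%:R / p%:R) + 1 / 2%:R :> R].
Proof.
have n_gt0 : (0 < n)%N by case/andP: ha => _ /(leq_ltn_trans (leq0n a)).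
have p_gt0 : (0 < p)%N by case: hp => -[].
have le_pn : (p <= n)%N by apply: period_modexp_le hp; rewrite // /coprime hcop.
have le_pN : (p <= N)%N.
  case/andP: hNn => /ltnW lt_n2N _; apply: leq_trans lt_n2N.
  by apply: leq_trans le_pn _; rewrite -[leqLHS]expn1 leq_pexp2l.
exists (fun k => nearest (k * N) p); split=> [|k].
  by apply: nearest_inj; rewrite p_gt0.
by rewrite mulrA -natrM; apply: nearest_itv.
Qed.
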